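(* Let $n\ge 6$. Let $C_{3,3}^{n-6}$ be the graph obtained from a path $u_1u_2\cdots u_{n-4}$ on $n-4$ vertices by adding new vertices $a,b,c,d$ and the edges $\{a,u_1\},\{b,u_1\},\{a,b\},\{c,u_{n-4}\},\{d,u_{n-4}\},\{c,d\}$ (i.e., two vertex-disjoint triangles joined by a path with $n-6$ internal vertices). Then $C_{3,3}^{n-6}$ is, up to isomorphism, the unique graph attaining the minimum algebraic connectivity over the class of all connected graphs on $n$ vertices without any pendant vertex.
   Context: All graphs are finite, simple and undirected. The Laplacian matrix of $G$ is $L(G)=D(G)-A(G)$ (degree matrix minus adjacency matrix), and the algebraic connectivity $\mu(G)$ is the second smallest eigenvalue of $L(G)$. A pendant vertex is a vertex of degree one. *)

(* Defs.v *)
From mathcomp Require Import all_boot all_order all_algebra.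
From mathcomp Require Import polyrcf.
From mathcomp Require Import reals.

Set Implicit Arguments.
Unset Strict Implicit.
Unset Printing Implicit Defensive.

Import Order.TTheory GRing.Theory Num.Theory.
Local Open Scope ring_scope.

Record sgraph := SGraph {
  vertex :> finType;
  adj : rel vertex;
  adj_sym : symmetric adj;
  adj_irr : irreflexive adj
}.

Section Graphs.
Variable G : sgraph.

Definition degree (x : G) : nat := #|[set y | adj x y]|.

Definition pendant (x : G) : bool := degree x == 1%N.

Definition connected_graph : Prop := (0 < #|G|)%N /\ forall x y : G, connect (@adj G) x y.

End Graphs.

Definition isomorphic (G H : sgraph) : Prop :=
  exists2 f : G -> H, bijective f & forall x y, adj (f x) (f y) = adj x y.

Section Laplacian.
Variables (R : rcfType) (G : sgraph).

(* Rows and columns are indexed through the enumeration of the vertices. *)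
Definition adjacency_mx : 'M[R]_#|G| :=
  \matrix_(i, j) (adj (enum_val i) (enum_val j))%:R.

Definition degree_mx : 'M[R]_#|G| :=
  diag_mx (\row_i (degree (enum_val i))%:R).

Definition laplacian_mx : 'M[R]_#|G| := degree_mx - adjacency_mx.

End Laplacian.

(* [rootsR p] lists the distinct roots of [p] in R in increasing order, so this
   is the nondecreasing list of the eigenvalues of [A] lying in R, each repeated
   according to its multiplicity; it is the full spectrum when [A] is symmetric. *)
Definition eigenvalues (R : rcfType) (m : nat) (A : 'M[R]_m) : seq R :=
  flatten [seq nseq (mup x (char_poly A)) x | x <- rootsR (char_poly A)].

(* Second smallest eigenvalue: index 1, counting from 0. *)
Definition algebraic_connectivity (R : rcfType) (G : sgraph) : R :=
  nth 0 (eigenvalues (laplacian_mx R G)) 1.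

Definition connected_no_pendant (n : nat) (G : sgraph) : Prop :=
  [/\ #|G| = n, connected_graph G & forall x : G, ~~ pendant x].

Definition minimizes_connectivity (R : rcfType) (P : sgraph -> Prop) (G : sgraph) : Prop :=
  P G /\ forall H, P H -> algebraic_connectivity R G <= algebraic_connectivity R H.

Section TwoTriangles.
Variable k : nat.

(* Vertices of C_{3,3}^k: [inl i] is the path vertex u_{i+1} (there are k + 2 of
   them); [inr (false, _)] are a and b, [inr (true, _)] are c and d. *)
Definition C33_vertex : finType := ('I_k.+2 + bool * bool)%type.

Definition path_end (s : bool) : 'I_k.+2 := if s then ord_max else ord0.

Definition C33_adj : rel C33_vertex := fun x y =>
  match x, y with
  | inl i, inl j => (i.+1 == j :> nat) || (j.+1 == i :> nat)
  | inl i, inr p | inr p, inl i => i == path_end p.1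
  | inr p, inr q => (p.1 == q.1) && (p.2 != q.2)
  end.

Lemma C33_adj_sym : symmetric C33_adj.
Proof.
move=> [i|p] [j|q] //=; first by rewrite orbC.
by rewrite eq_sym (eq_sym p.2).
Qed.

Lemma C33_adj_irr : irreflexive C33_adj.
Proof.
move=> [i|p] /=; last by rewrite !eqxx.
by rewrite orbb; apply/negbTE; rewrite neq_ltn ltnSn orbT.
Qed.

Definition C33 : sgraph := SGraph C33_adj_sym C33_adj_irr.

End TwoTriangles.

(* Main.v *)
(* Let y be an eigenvector of the second smallest Laplacian eigenvalue of a graph G
   in the class, list its values increasingly and let d_0, ..., d_{n-2} >= 0 be the
   consecutive gaps.  Then the quadratic form of L(G) at y is
   sum_{k,l} N(k,l) d_k d_l, where N(k,l) counts the edges of G crossing both gap k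
   and gap l.  Connectedness gives N(k,k) >= 1, minimum degree 2 gives
   N(0,0), N(1,1) >= 2 and N(0,1) >= 1, and symmetrically at the other end.  For
   C_{3,3}^{n-6}, in its natural order, these are the exact values and every other
   N(k,l) vanishes; so moving the sorted values to C_{3,3}^{n-6} does not increase
   the quadratic form.  In case of equality the sorted values form a monotone
   eigenvector of C_{3,3}^{n-6}, whose inner gaps are positive, hence no edge of G
   crosses two consecutive inner gaps and G is C_{3,3}^{n-6}. *)
Require Import Defs.
From mathcomp Require Import all_boot all_order all_algebra.
From mathcomp Require Import polyrcf complex spectral.
From mathcomp Require Import reals.
From mathcomp Require Import zify ring lra.

Set Implicit Arguments.
Unset Strict Implicit.
Unset Printing Implicit Defensive.

Import Order.TTheory GRing.Theory Num.Theory.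
Local Open Scope ring_scope.

(** * The second eigenvalue of a symmetric real matrix *)

(** Both lists are sorted, so it suffices to compare multiplicities: [x] occurs [mup x] times on the
    left, which is its number of occurrences among the linear factors. *)
Lemma eigenvalues_sort (R : rcfType) (m : nat) (A : 'M[R]_m) (s : seq R) :
  char_poly A = \prod_(x <- s) ('X - x%:P) -> eigenvalues A = sort <=%R s.
Proof.
move=> As; have p0 : char_poly A != 0 by rewrite monic_neq0 ?char_poly_monic.
have rootsP : sorted <%R (rootsR (char_poly A)) by rewrite sorted_roots.
have mem_roots x : (x \in rootsR (char_poly A)) = (x \in s).
  have := roots_on_rootsR p0 x; rewrite in_itv /= => <-.
  by rewrite As root_prod_XsubC.
apply: (sorted_eq le_trans le_anti); last 1 first.
- apply/allP => x _ /=; rewrite (permP (permEl (perm_sort _ _))).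
  rewrite /eigenvalues count_flatten -map_comp.
  rewrite (eq_map (_ : _ =1 fun y => if y == x then count_mem x s else 0)); last first.
    move=> y /=; rewrite count_nseq /= As mu_prod_XsubC eq_sym [x == y]eq_sym.
    by case: eqVneq => [->|]; rewrite ?mul1n ?mul0n.
  rewrite sumnE big_map -big_mkcond big_const_seq iter_addn_0.
  rewrite (count_uniq_mem _ (sorted_uniq lt_trans ltxx rootsP)) mem_roots.
  by rewrite -has_pred1 has_count; case: count => // k; rewrite muln1.
- rewrite /eigenvalues.
  elim: rootsR rootsP => //= x r IH; rewrite (path_sortedE lt_trans).
  case/andP => xr /IH; rewrite !(sorted_pairwise le_trans) pairwise_cat => ->.
  rewrite andbT; apply/andP; split.
    apply/allrelP => y z /nseqP [-> _] /flattenP [t /mapP [w wr ->]].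
    by case/nseqP => -> _; apply/ltW/(allP xr).
  by elim: (mup _ _) => //= k ->; rewrite andbT all_nseq lexx orbT.
- by rewrite sort_le_sorted.
Qed.

(** A zero that occurs once in a nonnegative list sorts to index 0, so index 1 holds the least
    nonzero entry. This is applied to the spectrum of a positive semidefinite matrix with
    one-dimensional kernel. *)
Lemma sort_second (R : realDomainType) (s : seq R) :
  all (>= 0) s -> count_mem 0 s = 1%N -> (1 < size s)%N ->
  let e := nth 0 (sort <=%R s) 1 in
  [/\ e \in s, 0 < e & forall x, x \in s -> x != 0 -> e <= x].
Proof.
move=> s0 c1; rewrite -(size_sort <=%R) /=.
have := sort_le_sorted s; have := mem_sort <=%R s.
rewrite -(permP (permEl (perm_sort <=%R s))) in c1.
case: (sort _ s) c1 => [|a [|b t]] //= c1 ms /andP [ab pt] _.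
have a_ge0 : 0 <= a by apply: (allP s0); rewrite -ms mem_head.
have pbt : all (>= b) t by apply: (order_path_min le_trans).
have b_ge0 : 0 <= b := le_trans a_ge0 ab.
have a0 : a = 0.
  apply/eqP; rewrite eq_le a_ge0 andbT.
  have : 0 \in s by rewrite -ms -has_pred1 has_count /= c1.
  rewrite -ms !inE => /or3P [/eqP <-//|/eqP -> //|/(allP pbt)]; exact: le_trans.
subst a; move: c1; rewrite eqxx /= add1n => /eqP; rewrite eqSS addn_eq0 => /andP [b0 _].
have bn0 : b != 0 by rewrite -eqb0.
split; first by rewrite -ms !inE eqxx orbT.
  by rewrite lt_neqAle eq_sym bn0.
move=> x; rewrite -ms !inE => /or3P [/eqP ->|/eqP -> //|/(allP pbt) //].
by rewrite eqxx.
Qed.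

Lemma char_poly_conj (F : comUnitRingType) (n : nat) (P Q D : 'M[F]_n) :
  Q *m P = 1%:M -> char_poly (Q *m D *m P) = char_poly D.
Proof.
move=> QP; have QP' : map_mx polyC Q *m map_mx polyC P = 1%:M.
  by rewrite -map_mxM QP map_scalar_mx.
rewrite /char_poly; have -> : char_poly_mx (Q *m D *m P) =
    map_mx polyC Q *m char_poly_mx D *m map_mx polyC P.
  rewrite /char_poly_mx mulmxBr mulmxBl !map_mxM /= mul_mx_scalar -scalemxAl.
  by rewrite QP' scalemx1.
by rewrite !det_mulmx mulrAC -det_mulmx QP' det1 mul1r.
Qed.

Section SymmetricReal.
Variables (R : rcfType) (n : nat) (A : 'M[R]_n).
Hypothesis A_sym : A^T = A.

Local Notation toC := (map_mx (real_complex R)).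
Local Notation "M ^t*" := (map_mx Num.conj (M^T)) (at level 30).

Lemma conj_real (x : R) : (x%:C)%C^* = (x%:C)%C.
Proof. by apply/CrealP/complex_realP; exists x. Qed.

Lemma conj_toC p q (M : 'M[R]_(p, q)) : map_mx Num.conj (toC M) = toC M.
Proof.
by apply/matrixP => i j; rewrite !mxE conj_real.
Qed.

Lemma dot_scale_real p (a b : R[i]) (v w : 'rV[R]_p) :
  ((a *: toC v) *m (b *: toC w)^t*) 0 0 = a * b^* * ((v *m w^T) 0 0)%:C%C.
Proof.
rewrite !mxE rmorph_sum mulr_sumr; apply: eq_bigr => k _.
by rewrite !mxE !rmorphM /= conj_real; ring.
Qed.

(** Over [R[i]] the matrix is Hermitian, hence unitarily diagonalizable with real spectrum. Only [d]
    is brought back to [R]; the basis [P] stays complex. *)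
Lemma symmetric_spectral : exists (P : 'M[R[i]]_n) (d : 'rV[R]_n),
  P \is unitarymx /\ toC A = P^t* *m diag_mx (toC d) *m P.
Proof.
have Ah : toC A \is hermsymmx.
  apply/is_hermitianmxP; rewrite expr0 scale1r.
  by rewrite map_trmx A_sym conj_toC.
have := orthomx_spectralP (hermitian_normalmx Ah).
have := hermitian_spectral_diag_real Ah.
have U := spectral_unitarymx (toC A).
rewrite invmx_unitary //.
move: (spectralmx _) (spectral_diag _) U => P d U /mxOverP dr Ae.
exists P, (\row_i complex.Re (d 0 i)); split=> //.
rewrite {1}Ae; congr (_ *m diag_mx _ *m _).
by apply/rowP => i; rewrite !mxE RRe_real.
Qed.

Variable u : 'rV[R]_n.
Hypothesis n_gt1 : (1 < n)%N.
Hypothesis A_psd : forall y : 'rV[R]_n, 0 <= (y *m A *m y^T) 0 0.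
Hypothesis u_ker : u *m A = 0.
Hypothesis u_neq0 : u != 0.
Hypothesis ker_u : forall y : 'rV[R]_n, y *m A = 0 -> exists c, y = c *: u.

Let mu := nth 0 (eigenvalues A) 1.

(** Kernels commute with extension of scalars, so a real spanning set of the kernel also spans the
    complex kernel. *)
Lemma kernel_complex (y : 'rV[R[i]]_n) : y *m toC A = 0 -> exists c, y = c *: toC u.
Proof.
move=> yA; have : (y <= kermx (toC A))%MS by apply/sub_kermxP.
rewrite -map_kermx => yk.
suff /(submx_trans yk)/sub_rVP : (toC (kermx A) <= toC u)%MS by [].
rewrite map_submx; apply/row_subP => i.
by have [|c ->] := ker_u (y := row i (kermx A)); rewrite ?scalemx_sub // -row_mul mulmx_ker row0.
Qed.

(** In an orthonormal eigenbasis the difference of the two sides is a sum of terms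
    [(d_i - mu) |w_i|^2]. For [y] orthogonal to [u] the terms with [d_i = 0] vanish, and [mu] is the
    least of the other [d_i]. Equality leaves only coordinates with [d_i = mu], so [y] is an
    eigenvector. *)
Lemma second_eigenvalue :
  [/\ 0 < mu,
      exists2 y : 'rV[R]_n, y != 0 & y *m A = mu *: y
    & forall y : 'rV[R]_n, y *m u^T = 0 ->
        mu * (y *m y^T) 0 0 <= (y *m A *m y^T) 0 0 ?= iff (y *m A == mu *: y)].
Proof.
have [P [d [PU Ad]]] := symmetric_spectral.
have PP : P *m P^t* = 1%:M by apply/unitarymxP.
have PP' : P^t* *m P = 1%:M by apply: mulmx1C.
have cpA : char_poly A = \prod_(x <- [seq d 0 i | i : 'I_n]) ('X - x%:P).
  apply: (map_poly_inj (real_complex R)).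
  rewrite map_char_poly Ad char_poly_conj // char_poly_trig ?diag_mx_is_trig //.
  rewrite big_map big_enum /= rmorph_prod; apply: eq_bigr => i _.
  by rewrite rmorphB /= map_polyX map_polyC !mxE eqxx mulr1n.
have eigA (i : 'I_n) : row i P *m toC A = (d 0 i)%:C%C *: row i P.
  rewrite -row_mul Ad !mulmxA PP mul1mx mul_diag_mx.
  by apply/rowP => j; rewrite !mxE.
have sqr_gt0 (y : 'rV[R]_n) : y != 0 -> 0 < (y *m y^T) 0 0.
  move=> y0; rewrite lt_neqAle eq_sym; have yy : (y *m y^T) 0 0 = \sum_i y 0 i ^+ 2.
    by rewrite mxE; apply: eq_bigr => i _; rewrite mxE expr2.
  rewrite yy sumr_ge0 ?andbT => [|i _]; last exact: sqr_ge0.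
  apply: contra_neq y0 => /(psumr_eq0P (fun i _ => sqr_ge0 _)) y0.
  by apply/rowP => i; rewrite mxE; apply/eqP; rewrite -sqrf_eq0 y0.
have eigR a : a \in [seq d 0 i | i : 'I_n] -> exists2 y : 'rV_n, y != 0 & y *m A = a *: y.
  rewrite -root_prod_XsubC -cpA -eigenvalue_root_char.
  by case/eigenvalueP => y ? ?; exists y.
have d_ge0 : all (>= 0) [seq d 0 i | i : 'I_n].
  apply/allP => a /eigR [y y0 yA] /=; have := A_psd y.
  by rewrite yA -scalemxAl mxE pmulr_lge0 ?sqr_gt0.
have row_ker i : d 0 i = 0 -> exists c, row i P = c *: toC u.
  by move=> di; apply: kernel_complex; rewrite eigA di scale0r.
(* The eigenvalue 0 is simple: two distinct rows of [P] on the line of [u] would be orthogonal unit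
   vectors that are proportional. *)
have d_inj0 i j : d 0 i = 0 -> d 0 j = 0 -> i = j.
  move=> /row_ker [c ci] /row_ker [c' cj]; apply/eqP; apply: contraT => ij.
  have dot k l : (row k P *m (row l P)^t*) 0 0 = (k == l)%:R.
    suff -> : (row k P *m (row l P)^t*) 0 0 = (P *m P^t*) k l by rewrite PP mxE.
    by rewrite !mxE; apply: eq_bigr => m _; rewrite !mxE.
  have := dot i i; have := dot i j; have := dot j j.
  rewrite !eqxx (negPf ij) ci cj !dot_scale_real => cjj cij cii.
  move/eqP: cij; rewrite !mulf_eq0 conjC_eq0 => /orP [/orP [] /eqP c0|/eqP u0].
  - by move/eqP: cii; rewrite c0 !mul0r eq_sym oner_eq0.
  - by move/eqP: cjj; rewrite c0 !mul0r eq_sym oner_eq0.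
  - by move/eqP: cjj; rewrite u0 mulr0 eq_sym oner_eq0.
have [i0 di0] : exists i, d 0 i = 0.
  have : root (char_poly A) 0.
    rewrite -eigenvalue_root_char; apply/eigenvalueP; exists u => //.
    by rewrite scale0r.
  by rewrite cpA root_prod_XsubC => /mapP [i _ ->]; exists i.
have zero1 : count_mem 0 [seq d 0 i | i : 'I_n] = 1%N.
  rewrite count_map (eq_count (_ : _ =1 pred1 i0)).
    by rewrite count_uniq_mem ?enum_uniq // mem_enum.
  by move=> i /=; apply/eqP/eqP => [di|->//]; exact: d_inj0.
have := sort_second d_ge0 zero1.
rewrite /= -(eigenvalues_sort cpA) -/mu size_map -cardE card_ord.
case=> // mu_in mu_gt0 mu_le; split=> //.
  exact: eigR.
move=> y yu.
(* Coordinates of [y] in the eigenbasis; their squared moduli [r i] below are real. *)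
pose w := toC y *m P^t*.
have w0 i : d 0 i = 0 -> w 0 i = 0.
  case/row_ker => c ci.
  have -> : w 0 i = ((1 *: toC y) *m (row i P)^t*) 0 0.
    by rewrite scale1r !mxE; apply: eq_bigr => k _; rewrite !mxE.
  by rewrite ci dot_scale_real yu mxE mulr0.
pose r i := complex.Re (w 0 i) ^+ 2 + complex.Im (w 0 i) ^+ 2.
have rE i : (r i)%:C%C = w 0 i * (w 0 i)^*.
  by rewrite /r add_Re2_Im2 normCK.
(* Both quadratic forms are diagonal in [w]: [wE] is used with [D = d] for [A] and with [D] constant
   1 for the identity. *)
have gap : (y *m A *m y^T) 0 0 - mu * (y *m y^T) 0 0 = \sum_i (d 0 i - mu) * r i.
  have wE (D : 'rV[R]_n) : (toC y *m (P^t* *m diag_mx (toC D) *m P) *m (toC y)^t*) 0 0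
      = (\sum_i D 0 i * r i)%:C%C.
    have -> : toC y *m (P^t* *m diag_mx (toC D) *m P) *m (toC y)^t* =
        w *m diag_mx (toC D) *m w^t*.
      by rewrite /w trmx_mul map_mxM trmxCK !mulmxA.
    have -> : w *m diag_mx (toC D) *m w^t* =
        \col_(_ < 1) \sum_i (D 0 i)%:C%C * (w 0 i * (w 0 i)^*).
      apply/colP => j; rewrite ord1 mul_mx_diag !mxE; apply: eq_bigr => i _.
      by move: (w) => v; rewrite !mxE; ring.
    by rewrite mxE rmorph_sum; apply: eq_bigr => i _; rewrite rmorphM /= rE.
  apply: complexI; have -> : \sum_i (d 0 i - mu) * r i =
      \sum_i d 0 i * r i - mu * \sum_i (const_mx 1 : 'rV[R]_n) 0 i * r i.
    by rewrite mulr_sumr -sumrB; apply: eq_bigr => i _; rewrite mxE; ring.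
  rewrite !rmorphB !rmorphM /= -!wE -Ad map_const_mx rmorph1 diag_const_mx.
  rewrite mulmx1 PP' mulmx1.
  have -> : (toC y)^t* = toC (y^T) by rewrite map_trmx conj_toC.
  by rewrite -!map_mxM !mxE.
have term_ge0 i : 0 <= (d 0 i - mu) * r i.
  have [/w0 wi|di] := eqVneq (d 0 i) 0; first by rewrite /r wi /= expr0n addr0 mulr0.
  apply: mulr_ge0; last by rewrite addr_ge0 ?sqr_ge0.
  by rewrite subr_ge0 mu_le // map_f ?mem_enum.
split; first by rewrite -subr_ge0 gap sumr_ge0.
apply/eqP/eqP => [/eqP|->]; last by rewrite -scalemxAl [RHS]mxE.
rewrite eq_sym -subr_eq0 gap => /eqP /(psumr_eq0P (fun i _ => term_ge0 i)) terms0.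
apply: (@map_mx_inj _ _ (real_complex R)).
rewrite map_mxM map_mxZ Ad -[toC y in RHS](mulmx1) -PP' !mulmxA scalemxAl -/w.
rewrite mul_mx_diag; congr (_ *m _); apply/rowP => i; rewrite !mxE.
have /eqP := terms0 i isT; rewrite mulf_eq0 subr_eq0 => /orP [/eqP -> |].
  by rewrite mulrC.
move=> /eqP ri; have /eqP : (r i)%:C%C = 0 :> R[i] by rewrite ri.
by rewrite rE mulf_eq0 conjC_eq0 orbb !mxE => /eqP ->; rewrite mul0r mulr0.
Qed.

End SymmetricReal.

(** * Rayleigh quotients of the Laplacian *)

Section Energy.
Variables (R : realDomainType) (T : finType) (e : rel T).
Implicit Type f : T -> R.

(** The sum runs over ordered pairs, so for symmetric [e] it is twice the Laplacian quadratic form;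
    hence the factors 2 below. *)
Definition energy f := \sum_x \sum_y (e x y)%:R * (f x - f y) ^+ 2.

Definition lap f x := \sum_y (e x y)%:R * (f x - f y).

Lemma energy_ge0 f : 0 <= energy f.
Proof. by do 2![apply: sumr_ge0 => ? _]; rewrite mulr_ge0 ?ler0n ?sqr_ge0. Qed.

Lemma energy_lap f : symmetric e -> energy f = 2 * \sum_x f x * lap f x.
Proof.
move=> e_sym; rewrite [2 * _]mulr_natl mulr2n.
have lapE : \sum_x f x * lap f x = \sum_x \sum_y (e x y)%:R * (f x - f y) * f x.
  apply: eq_bigr => x _; rewrite mulr_sumr; apply: eq_bigr => y _.
  by rewrite mulrC.
rewrite {2}lapE exchange_big lapE -big_split; apply: eq_bigr => x _.
rewrite -big_split; apply: eq_bigr => y _ /=.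
by rewrite (e_sym y x); ring.
Qed.

Lemma energy0_edge f x y : energy f = 0 -> e x y -> f x = f y.
Proof.
have ge0 a b : 0 <= (e a b)%:R * (f a - f b) ^+ 2.
  by rewrite mulr_ge0 ?ler0n ?sqr_ge0.
move=> /(psumr_eq0P (fun a _ => sumr_ge0 _ (fun b _ => ge0 a b)))/(_ x isT).
move=> /(psumr_eq0P (fun b _ => ge0 x b))/(_ y isT) /eqP + exy.
by rewrite exy mul1r sqrf_eq0 subr_eq0 => /eqP.
Qed.

End Energy.

Lemma energy_bij (R : realDomainType) (S T : finType) (h : S -> T) (e : rel T) (e' : rel S)
    (f : T -> R) :
  bijective h -> (forall x y, e' x y = e (h x) (h y)) ->
  energy e f = energy e' (f \o h).
Proof.
move=> bh ee; rewrite /energy (reindex h) /=; last exact: onW_bij.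
apply: eq_bigr => x _; rewrite (reindex h) /=; last exact: onW_bij.
by apply: eq_bigr => y _; rewrite ee.
Qed.

Section GraphConnectivity.
Variables (R : rcfType) (G : sgraph).
Local Notation L := (laplacian_mx R G).
Local Notation e := (@adj G).
Local Notation fn y := (fun x : G => y 0 (enum_rank x)).

Lemma sum_enum_rank (F : 'I_#|G| -> R) : \sum_i F i = \sum_(x : G) F (enum_rank x).
Proof. by rewrite (reindex (@enum_rank G)) //; apply/onW_bij/enum_rank_bij. Qed.

Lemma laplacian_sym : L^T = L.
Proof.
apply/matrixP => i j; rewrite !mxE adj_sym; congr (_ - _).
by rewrite eq_sym; case: eqVneq => [->|].
Qed.

Lemma mul_laplacian (y : 'rV[R]_#|G|) x : (y *m L) 0 (enum_rank x) = lap e (fn y) x.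
Proof.
rewrite /laplacian_mx mulmxBr mul_mx_diag !mxE /lap.
under [RHS]eq_bigr do rewrite mulrBr.
rewrite sumrB; congr (_ - _).
  rewrite -mulr_suml enum_rankK /degree -natr_sum mulrC; congr (_%:R * _).
  by rewrite -sum1_card big_mkcond; apply: eq_bigr => z _; rewrite inE; case: adj.
rewrite sum_enum_rank; apply: eq_bigr => z _.
by rewrite !mxE !enum_rankK adj_sym mulrC.
Qed.

Lemma quad_laplacian (y : 'rV[R]_#|G|) :
  energy e (fn y) = 2 * (y *m L *m y^T) 0 0.
Proof.
rewrite (energy_lap _ (@adj_sym G)) [X in _ = 2 * X]mxE sum_enum_rank; congr (2 * _).
by apply: eq_bigr => x _; rewrite -mul_laplacian !mxE mulrC.
Qed.

Lemma quad_id (y : 'rV[R]_#|G|) : (y *m y^T) 0 0 = \sum_x fn y x ^+ 2.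
Proof. by rewrite mxE sum_enum_rank; apply: eq_bigr => x _; rewrite mxE expr2. Qed.

(** The variational characterization of [mu], in terms of functions on vertices. A kernel vector has
    zero energy, hence is constant along paths; connectedness thus makes the kernel the line of
    constants, and [second_eigenvalue] applies. *)
Lemma algebraic_connectivity_spec :
  let mu := algebraic_connectivity R G in
  connected_graph G -> (1 < #|G|)%N ->
  [/\ 0 < mu,
      exists f : G -> R, [/\ \sum_x f x = 0, 0 < \sum_x f x ^+ 2
                           & energy e f = 2 * (mu * \sum_x f x ^+ 2)]
    & forall f : G -> R, \sum_x f x = 0 ->
      2 * (mu * \sum_x f x ^+ 2) <= energy e f /\
      (energy e f = 2 * (mu * \sum_x f x ^+ 2) -> forall x, lap e f x = mu * f x)].
Proof.
move=> mu [_ Gconn] G_gt1.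
pose u : 'rV[R]_#|G| := const_mx 1.
have lap1 : u *m L = 0.
  apply/rowP => i; rewrite -(enum_valK i) mul_laplacian mxE /lap big1 // => z _.
  by rewrite !mxE subrr mulr0.
have u0 : u != 0.
  apply/eqP => /rowP /(_ (Ordinal (ltnW G_gt1))) /eqP.
  by rewrite !mxE oner_eq0.
have psd (y : 'rV[R]_#|G|) : 0 <= (y *m L *m y^T) 0 0.
  by have := energy_ge0 e (fn y); rewrite quad_laplacian pmulr_rge0.
have ker (y : 'rV[R]_#|G|) : y *m L = 0 -> exists c, y = c *: u.
  move=> yL; have y0 : energy e (fn y) = 0.
    by rewrite quad_laplacian yL mul0mx mxE mulr0.
  exists (y 0 (Ordinal (ltnW G_gt1))); apply/rowP => i; rewrite !mxE mulr1.
  set j := Ordinal _; rewrite -(enum_valK i) -(enum_valK j).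
  case/connectP: (Gconn (enum_val i) (enum_val j)) => p pp ->.
  elim: p (enum_val i) pp => //= z p IH x /andP [xz /IH <-].
  exact: (energy0_edge y0 xz).
have [mu_gt0 [y y0 yL] mu_le] := second_eigenvalue laplacian_sym G_gt1 psd lap1 u0 ker.
have dotu (z : 'rV[R]_#|G|) : (z *m u^T) 0 0 = \sum_x fn z x.
  by rewrite mxE sum_enum_rank; apply: eq_bigr => x _; rewrite !mxE mulr1.
split=> //.
  exists (fn y); split; last by rewrite quad_laplacian yL -scalemxAl mxE quad_id.
    (* Symmetry moves [L] onto the constant vector, so [mu] times the sum of [y] is 0, while [mu] is
       positive. *)
    rewrite -dotu; have : y *m L *m u^T = 0.
      by rewrite -{1}laplacian_sym -mulmxA -trmx_mul lap1 trmx0 mulmx0.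
    rewrite yL -scalemxAl => /matrixP /(_ 0 0).
    rewrite [LHS]mxE [RHS]mxE => /eqP.
    by rewrite mulf_eq0 gt_eqF //= => /eqP.
  rewrite lt_neqAle sumr_ge0 ?andbT => [|x _]; last exact: sqr_ge0.
  apply: contra_neq y0 => /esym /(psumr_eq0P (fun x _ => sqr_ge0 _)) y0.
  by apply/rowP => i; apply/eqP; rewrite mxE -sqrf_eq0 -(enum_valK i) y0.
move=> f f0; pose z : 'rV[R]_#|G| := \row_i f (enum_val i).
have zE x : fn z x = f x by rewrite mxE enum_rankK.
have zu : z *m u^T = 0.
  apply/matrixP => i j; rewrite !ord1 dotu [RHS]mxE -[RHS]f0; apply: eq_bigr => x _; exact: zE.
have enE : energy e f = energy e (fn z).
  by do 2![apply: eq_bigr => ? _]; rewrite !zE.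
have sqE : \sum_x f x ^+ 2 = \sum_x fn z x ^+ 2.
  by apply: eq_bigr => ? _; rewrite !zE.
have [le_mu eq_mu] := mu_le _ zu.
rewrite enE sqE quad_laplacian -quad_id; split; first by rewrite ler_pM2l.
have two0 : (2 : R) != 0 by rewrite pnatr_eq0.
move=> /(mulfI two0) zL x.
have /eqP zeig : z *m L == mu *: z by rewrite -eq_mu zL.
rewrite -[in RHS]zE; have := mul_laplacian z x.
rewrite zeig mxE => ->; rewrite /lap; apply: eq_bigr => ? _; by rewrite !zE.
Qed.

End GraphConnectivity.

(** * Edges crossing the gaps of a linear arrangement *)

Section Gaps.
Variables (R : realDomainType) (N : nat) (g : nat -> R).
Implicit Type e : rel 'I_N.+1.

Definition gap k := g k.+1 - g k.

(** The bounds force [p.1 < p.2], so each undirected edge is counted once. *)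
Definition crossing e (k l : nat) : {set 'I_N.+1 * 'I_N.+1} :=
  [set p | [&& e p.1 p.2, (p.1 <= minn k l)%N & (maxn k l < p.2)%N]].

Lemma crossingC e k l : crossing e k l = crossing e l k.
Proof. by rewrite /crossing minnC maxnC. Qed.

(** Telescoping, with indicators so that the range of summation is independent of [i] and [j] and
    the sums can later be exchanged. *)
Lemma gap_sum (i j : nat) : (i <= j <= N)%N ->
  g j - g i = \sum_(k < N) ((i <= k) && (k < j))%N%:R * gap k.
Proof.
case/andP => ij jN; rewrite -telescope_sumr //.
rewrite -(big_mkord xpredT (fun k => ((i <= k) && (k < j))%N%:R * gap k)).
rewrite (big_cat_nat (leq0n i)) ?(leq_trans ij) //= (big_cat_nat ij jN) /=.
rewrite [X in X + _]big_nat_cond [X in X + _]big1 => [|k]; last first.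
  by case/andP => /andP [_ ki] _; rewrite leqNgt ki mul0r.
rewrite [X in _ + (_ + X)]big_nat_cond [X in _ + (_ + X)]big1 => [|k]; last first.
  by case/andP => /andP [jk _] _; rewrite ltnNge jk andbF mul0r.
rewrite add0r addr0; apply: eq_big_nat => k ->; by rewrite mul1r.
Qed.

Lemma energy_crossing e : symmetric e ->
  energy e (fun i => g i) =
  2 * \sum_(k < N) \sum_(l < N) #|crossing e k l|%:R * (gap k * gap l).
Proof.
move=> e_sym.
(* The share of the pair [p] in the double sum: the squared difference expanded in gaps if [p] is an
   increasing edge, and 0 otherwise. *)
pose h (p : 'I_N.+1 * 'I_N.+1) := \sum_(k < N) \sum_(l < N)
  (p \in crossing e k l)%:R * (gap k * gap l).
have hE (i j : 'I_N.+1) : h (i, j) = if (i < j)%N then (e i j)%:R * (g i - g j) ^+ 2 else 0.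
  case: ltnP => ij; last first.
    rewrite /h big1 // => k _; rewrite big1 // => l _; rewrite inE /=.
    by case: and3P => [[]|]; rewrite ?mul0r //; lia.
  have -> : g i - g j = - (g j - g i) by rewrite opprB.
  rewrite sqrrN gap_sum ?(ltnW ij) ?leq_ord // expr2 mulr_suml mulr_sumr.
  apply: eq_bigr => k _; rewrite mulr_sumr mulr_sumr; apply: eq_bigr => l _.
  rewrite [X in _ = _ * X]mulrACA [RHS]mulrA -!natrM; congr (_%:R * _); rewrite inE /=.
  rewrite leq_min gtn_max.
  by case: (e i j); case: (i <= k)%N; case: (i <= l)%N; case: (k < j)%N; case: (l < j)%N.
have -> : \sum_(k < N) \sum_(l < N) #|crossing e k l|%:R * (gap k * gap l) = \sum_p h p.
  rewrite [RHS]exchange_big; apply: eq_bigr => k _.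
  rewrite [RHS]exchange_big; apply: eq_bigr => l _.
  rewrite -mulr_suml -natr_sum -sum1_card; congr (_%:R * _); rewrite [LHS]big_mkcond /=.
  by apply: eq_bigr => p _; case: (p \in _).
have -> : \sum_p h p = \sum_i \sum_j h (i, j).
  by rewrite (pair_bigA _ (fun i j => h (i, j))) /=; apply: eq_bigr => -[].
rewrite [RHS]mulr_natl mulr2n.
rewrite {2}exchange_big -big_split; apply: eq_bigr => i _.
rewrite -big_split; apply: eq_bigr => j _ /=; rewrite !hE (e_sym j i).
case: ltngtP => [_|_|/val_inj ->]; rewrite ?(addr0, add0r) //; last first.
  by rewrite subrr expr0n mulr0.
by rewrite -sqrrN opprB.
Qed.

End Gaps.

(* [C33] with its vertices placed in the order a, b, u_1, ..., u_{n-4}, c, d: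
   a path on positions 0, ..., N together with the chords {0,2} and {N-2,N}. *)
Definition chain_arc (N i j : nat) : bool :=
  [|| j == i.+1, (i == 0) && (j == 2) | (i.+2 == N) && (j == N)]%N.

Definition chain (N : nat) : rel 'I_N.+1 :=
  fun i j => chain_arc N i j || chain_arc N j i.

Lemma chain_sym N : symmetric (@chain N).
Proof. by move=> i j; rewrite /chain orbC. Qed.

(** * Minimality of the crossing numbers of the chain *)

Section Compare.
Variables (N : nat) (e : rel 'I_N.+1).
Hypothesis N_ge5 : (5 <= N)%N.
Hypothesis e_irr : irreflexive e.
Hypothesis e_sym : symmetric e.
Hypothesis e_deg : forall x z, exists2 y, y != z & e x y.
Hypothesis e_cut : forall k, (k < N)%N ->
  exists i j : 'I_N.+1, [/\ (i <= k)%N, (k < j)%N & e i j].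

(** Minimum degree two enters through [e_deg], as a neighbour avoiding a prescribed vertex; the
    inequalities are put in [nat] for arithmetic. *)
Lemma neighbour (x z : 'I_N.+1) : exists2 y, e x y & (y != z :> nat) && (y != x :> nat).
Proof.
have [y yz exy] := e_deg x z; exists y => //; move: yz; rewrite -val_eqE => -> /=.
by apply: contraTneq exy => /val_inj ->; rewrite e_irr.
Qed.

Lemma in_crossing (f : rel 'I_N.+1) k l (i j : 'I_N.+1) :
  ((i, j) \in crossing f k l) =
  [&& f i j, (i <= k)%N, (i <= l)%N, (k < j)%N & (l < j)%N].
Proof. by rewrite inE /= leq_min gtn_max !andbA. Qed.

Lemma crossing_card0 k l :
  (forall i j : 'I_N.+1, ~~ [&& chain i j, (i <= k)%N, (i <= l)%N, (k < j)%N & (l < j)%N]) ->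
  (#|crossing (@chain N) k l| <= #|crossing e k l|)%N.
Proof.
move=> C; rewrite (_ : crossing (@chain N) k l = set0) ?cards0 //.
by apply/setP => -[i j]; rewrite in_crossing inE; apply: negbTE.
Qed.

Lemma crossing_card1 k l (i j : 'I_N.+1) (x y : nat) :
  [&& e i j, (i <= k)%N, (i <= l)%N, (k < j)%N & (l < j)%N] ->
  (forall i' j' : 'I_N.+1, [&& chain i' j', (i' <= k)%N, (i' <= l)%N, (k < j')%N & (l < j')%N] ->
     (i' = x :> nat) /\ (j' = y :> nat)) ->
  (#|crossing (@chain N) k l| <= #|crossing e k l|)%N.
Proof.
rewrite -in_crossing => ij C.
apply: (@leq_trans 1); last by apply/card_gt0P; exists (i, j).
apply/card_le1_eqP => -[a b] [c d]; rewrite !in_crossing.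
by move=> /C [ax yb] /C [cx dy]; congr (_, _); apply/val_inj; rewrite /= ?ax ?cx ?yb ?dy.
Qed.

(** Here [s] and [t] are the only candidates for crossing edges of the chain, while [p] and [q]
    witness two crossing edges of [e]. *)
Lemma crossing_card2 k l (p q : 'I_N.+1 * 'I_N.+1) (s : nat * nat) (t : nat * nat) :
  p != q -> p \in crossing e k l -> q \in crossing e k l ->
  (forall i j : 'I_N.+1, [&& chain i j, (i <= k)%N, (i <= l)%N, (k < j)%N & (l < j)%N] ->
     (i : nat, j : nat) \in [:: s; t]) ->
  (#|crossing (@chain N) k l| <= #|crossing e k l|)%N.
Proof.
move=> pq pin qin C; apply: (@leq_trans 2).
  pose h (r : 'I_N.+1 * 'I_N.+1) := (r.1 : nat, r.2 : nat).
  rewrite cardE -(size_map h); apply: (@uniq_leq_size _ _ [:: s; t]).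
    rewrite map_inj_uniq ?enum_uniq // => -[a b] [c d] [ac bd].
    by congr (_, _); apply: val_inj.
  by move=> _ /mapP [[i j]] + ->; rewrite mem_enum in_crossing; apply: C.
rewrite cardE; apply: (@uniq_leq_size _ [:: p; q]); first by rewrite /= inE pq.
by move=> r; rewrite !inE mem_enum => /orP [] /eqP ->.
Qed.

Lemma crossing_chain_le k l : (k < N)%N -> (l < N)%N ->
  (#|crossing (@chain N) k l| <= #|crossing e k l|)%N.
Proof.
wlog kl : k l / (k <= l)%N => [th|kN lN].
  case: (leqP k l) => [/th//|/ltnW/th th' kN lN].
  by rewrite crossingC [X in (_ <= #|pred_of_set X|)%N]crossingC th'.
have N0 : (0 < N.+1)%N by []. have N1 : (1 < N.+1)%N by lia.
have M0 : (N < N.+1)%N by []. have M1 : (N.-1 < N.+1)%N by lia.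
(* Witnesses at the left end: [j0] avoids 1, so its edge from 0 crosses gaps 0 and 1; [j0'] gives a
   second edge at 0; [j1] avoids 0, so its edge from 1 crosses gap 1. The right end is symmetric. *)
have [j0 e0 /andP [j01 j00]] := neighbour (Ordinal N0) (Ordinal N1).
have [j0' e0' /andP [j01' j00']] := neighbour (Ordinal N0) j0.
have [j1 e1 /andP [j10 j11]] := neighbour (Ordinal N1) (Ordinal N0).
have [iN eN /andP [iN1 iN0]] := neighbour (Ordinal M0) (Ordinal M1).
have [iN' eN' /andP [iN1' iN0']] := neighbour (Ordinal M0) iN.
have [i1 eM /andP [i10 i11]] := neighbour (Ordinal M1) (Ordinal M0).
rewrite /= in j01 j00 j01' j00' j10 j11 iN1 iN0 iN1' iN0' i10 i11.
rewrite e_sym in eN; rewrite e_sym in eN'; rewrite e_sym in eM.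
have in_cross (i j : 'I_N.+1) : e i j -> (i <= k)%N -> (l < j)%N -> (i, j) \in crossing e k l.
  by move=> eij ik lj; rewrite in_crossing eij; lia.
have [iNle iN'le i1le] : [/\ (iN <= N)%N, (iN' <= N)%N & (i1 <= N)%N] by split; apply: leq_ord.
have [k0|k0] := eqVneq k 0%N.
  have [l0|l0] := eqVneq l 0%N.
    apply: (@crossing_card2 _ _ (Ordinal N0, j0) (Ordinal N0, j0') (0, 1)%N (0, 2)%N).
    - by rewrite xpair_eqE eqxx /= -val_eqE /= eq_sym.
    - by apply: in_cross => //=; lia.
    - by apply: in_cross => //=; lia.
    - by move=> i j; rewrite /chain /chain_arc !inE !xpair_eqE /=; lia.
  have [l1|l1] := eqVneq l 1%N.
    apply: (@crossing_card1 _ _ (Ordinal N0) j0 0 2).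
    - by rewrite -in_crossing; apply: in_cross => //=; lia.
    - by move=> i j; rewrite /chain /chain_arc; lia.
  by apply: crossing_card0 => i j; rewrite /chain /chain_arc; lia.
have [lM|lM] := eqVneq l N.-1.
  have [kM|kM] := eqVneq k N.-1.
    apply: (@crossing_card2 _ _ (iN, Ordinal M0) (iN', Ordinal M0) (N.-1, N)%N (N.-2, N)%N).
    - by rewrite xpair_eqE eqxx andbT /= -val_eqE /= eq_sym.
    - by apply: in_cross => //=; lia.
    - by apply: in_cross => //=; lia.
    - by move=> i j; rewrite /chain /chain_arc !inE !xpair_eqE /=; lia.
  have [kM2|kM2] := eqVneq k N.-2.
    apply: (@crossing_card1 _ _ iN (Ordinal M0) N.-2 N).
    - by rewrite -in_crossing; apply: in_cross => //=; lia.
    - by move=> i j; rewrite /chain /chain_arc; lia.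
  by apply: crossing_card0 => i j; rewrite /chain /chain_arc; lia.
have [kl_eq|kl_neq] := eqVneq k l; last first.
  by apply: crossing_card0 => i j; rewrite /chain /chain_arc; lia.
have [k1|k1] := eqVneq k 1%N.
  apply: (@crossing_card2 _ _ (Ordinal N0, j0) (Ordinal N1, j1) (0, 2)%N (1, 2)%N).
  - by rewrite xpair_eqE -val_eqE.
  - by apply: in_cross => //=; lia.
  - by apply: in_cross => //=; lia.
  - by move=> i j; rewrite /chain /chain_arc !inE !xpair_eqE /=; lia.
have [kM|kM] := eqVneq k N.-2.
  apply: (@crossing_card2 _ _ (iN, Ordinal M0) (i1, Ordinal M1) (N.-2, N)%N (N.-2, N.-1)%N).
  - by rewrite xpair_eqE -[_ == Ordinal M1]val_eqE /= andbC; apply/negP; lia.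
  - by apply: in_cross => //=; lia.
  - by apply: in_cross => //=; lia.
  - by move=> i j; rewrite /chain /chain_arc !inE !xpair_eqE /=; lia.
(* Away from the ends only [{k, k+1}] crosses gap [k] in the chain, and connectedness of [e]
   supplies a matching edge. *)
have [i [j [ik kj eij]]] := e_cut kN.
apply: (@crossing_card1 _ _ i j k k.+1).
- by rewrite -in_crossing; apply: in_cross => //; lia.
- by move=> i' j'; rewrite /chain /chain_arc; lia.
Qed.

(* An edge outside the chain would cross two consecutive inner gaps; degrees and
   cuts then force every edge of the chain to be present. *)
Lemma crossing0_chain :
  (forall k, (0 < k)%N -> (k.+2 < N)%N -> crossing e k k.+1 = set0) ->
  forall i j, e i j = chain i j.
Proof.
move=> cr0.
have sub_lt (i j : 'I_N.+1) : (i < j)%N -> e i j -> chain i j.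
  move=> ij eij; apply: contraT => /negP nc.
  (* For [i = 0] a pair outside the chain has [j >= 3] and crosses gaps 1 and 2; otherwise it
     crosses gaps [i] and [i+1]. Excluding the chord [{N-2, N}] keeps [k.+2 < N]. *)
  have jN := leq_ord j; pose k := maxn i 1.
  have : (i, j) \in crossing e k k.+1.
    rewrite in_crossing eij /k; move: nc; rewrite /chain /chain_arc; lia.
  by rewrite cr0 ?inE // /k; move: nc; rewrite /chain /chain_arc; lia.
have sub (i j : 'I_N.+1) : e i j -> chain i j.
  case: (ltngtP i j) => [/sub_lt//|ji|/val_inj ->]; last by rewrite e_irr.
  by rewrite e_sym chain_sym; apply: sub_lt.
have sup_lt (i j : 'I_N.+1) : (i < j)%N -> chain i j -> e i j.
  move=> ij cij; have jN := leq_ord j.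
  have eW (x y y' : 'I_N.+1) : e x y -> y = y' :> nat -> e x y'.
    by move=> exy /val_inj <-.
  (* An end position has only two possible neighbours in the chain and at least two in [e], so both
     occur; the other end and the positions 1 and [N.-1] are treated likewise. *)
  have [i0|i0] := eqVneq (i : nat) 0%N.
    have [y ey /andP [_ y0]] := neighbour i i; have [y' ey' /andP [yy' y0']] := neighbour i y.
    have [cy cy'] := (sub _ _ ey, sub _ _ ey').
    have [yj|yj] := eqVneq (y : nat) j; first exact: eW ey yj.
    apply: (eW _ _ _ ey'); move: cij cy cy'; rewrite /chain /chain_arc; lia.
  have [jN'|jN'] := eqVneq (j : nat) N.
    rewrite e_sym.
    have [y ey /andP [_ y0]] := neighbour j j; have [y' ey' /andP [yy' y0']] := neighbour j y.
    have [cy cy'] := (sub _ _ ey, sub _ _ ey').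
    have [yi|yi] := eqVneq (y : nat) i; first exact: eW ey yi.
    apply: (eW _ _ _ ey'); have := (leq_ord y, leq_ord y') => - [].
    move: cij cy cy'; rewrite /chain /chain_arc; lia.
  have [i1|i1] := eqVneq (i : nat) 1%N.
    have [y ey /andP [y0 y1]] := neighbour i ord0; have cy := sub _ _ ey.
    by apply: (eW _ _ _ ey); move: y0 cij cy; rewrite /chain /chain_arc /=; lia.
  have [jM|jM] := eqVneq (j : nat) N.-1.
    rewrite e_sym.
    have [y ey /andP [y0 y1]] := neighbour j ord_max; have cy := sub _ _ ey.
    by apply: (eW _ _ _ ey); move: y0 cij cy; rewrite /chain /chain_arc /=; lia.
  have iN : (i < N)%N by lia.
  have [i' [j' [ii' ij' eij']]] := e_cut iN; have cij' := sub _ _ eij'.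
  have [ei ej] : (i' = i :> nat) /\ (j' = j :> nat).
    by move: cij cij'; rewrite /chain /chain_arc; lia.
  by rewrite -(val_inj ei) -(val_inj ej).
move=> i j; apply/idP/idP => [/sub//|cij].
case: (ltngtP i j) => [/sup_lt -> //|ji|/val_inj ij].
  by rewrite e_sym sup_lt // chain_sym.
by move: cij; rewrite ij /chain /chain_arc; lia.
Qed.

End Compare.

Lemma crossing_chain0 (N l : nat) : (0 < l)%N -> (l.+2 < N)%N ->
  crossing (@chain N) l l.+1 = set0.
Proof.
move=> l0 lN; apply/setP => -[i j]; rewrite in_crossing inE; apply/negbTE.
by rewrite /chain /chain_arc; lia.
Qed.

Section ChainEnergy.
Variables (R : realDomainType) (N : nat) (e : rel 'I_N.+1) (g : nat -> R).
Hypothesis N_ge5 : (5 <= N)%N.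
Hypothesis e_irr : irreflexive e.
Hypothesis e_sym : symmetric e.
Hypothesis e_deg : forall x z, exists2 y, y != z & e x y.
Hypothesis e_cut : forall k, (k < N)%N ->
  exists i j : 'I_N.+1, [/\ (i <= k)%N, (k < j)%N & e i j].
Hypothesis gap_ge0 : forall k, (k < N)%N -> 0 <= gap g k.

(** The comparison is made coefficient by coefficient, since products of gaps are nonnegative.
    Equality then forces equal crossing numbers at every pair of gaps with nonzero product. *)
Lemma energy_chain_le :
  energy (@chain N) (fun i => g i) <= energy e (fun i => g i)
    ?= iff [forall k : 'I_N, forall l : 'I_N, (gap g k * gap g l == 0) ||
              (#|crossing (@chain N) k l| == #|crossing e k l|)].
Proof.
rewrite !energy_crossing //; last exact: chain_sym.
rewrite (mono_leif (ler_pM2l _)) ?ltr0n //.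
apply: leif_sum => k _; apply: leif_sum => l _.
have g0 : 0 <= gap g k * gap g l by rewrite mulr_ge0 ?gap_ge0.
split; first by rewrite ler_wpM2r // ler_nat crossing_chain_le.
by rewrite -subr_eq0 -mulrBl mulf_eq0 subr_eq0 eqr_nat orbC.
Qed.

End ChainEnergy.

(** Discrete divergence theorem: contributions of edges inside [A] cancel by antisymmetry, leaving
    the flux through the boundary. *)
Lemma lap_cut (R : realDomainType) (T : finType) (e : rel T) (f : T -> R) (A : pred T) :
  symmetric e ->
  \sum_(x | A x) lap e f x = \sum_(x | A x) \sum_(y | ~~ A y) (e x y)%:R * (f x - f y).
Proof.
move=> e_sym; under eq_bigr do rewrite /lap (bigID A) /=.
rewrite big_split /=; set S := (X in X + _ = _).
suff -> : S = 0 by rewrite add0r.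
have SN : S = - S.
  rewrite {1}/S exchange_big -sumrN; apply: eq_bigr => x _.
  by rewrite -sumrN; apply: eq_bigr => y _; rewrite e_sym; ring.
by apply/eqP; rewrite -[_ == 0](@mulrn_eq0 _ _ 2) mulr2n {1}SN addNr.
Qed.

(** * Monotone eigenvectors of the chain *)

Lemma chain_arc_rev (N i j : nat) : (i <= N)%N -> (j <= N)%N ->
  chain_arc N (N - i) (N - j) = chain_arc N j i.
Proof.
move=> iN jN; rewrite /chain_arc [X in _ = _ || X]orbC.
congr [|| _, _ | _]; apply/idP/idP; lia.
Qed.

Lemma chain_rev (N : nat) (i j : 'I_N.+1) :
  chain i (rev_ord j) = chain (rev_ord i) j.
Proof.
rewrite /chain /= !subSS -{1 2}(subKn (leq_ord i)).
by rewrite !chain_arc_rev ?leq_ord ?leq_subr // orbC.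
Qed.

Section ChainEigenvector.
Variables (R : realDomainType) (N : nat) (mu : R).
Hypothesis N_ge5 : (5 <= N)%N.
Hypothesis mu_gt0 : 0 < mu.

Definition chain_eigen (g : nat -> R) :=
  [/\ forall i j, (i <= j <= N)%N -> g i <= g j,
      \sum_(i < N.+1) g i = 0
    & forall i : 'I_N.+1, lap (@chain N) (fun j => g j) i = mu * g i].

(** Reversal is a symmetry of the chain, and the sign restores monotonicity. This transfers results
    from the left end to the right end. *)
Lemma chain_eigen_rev g : chain_eigen g -> chain_eigen (fun i => - g (N - i)%N).
Proof.
case=> mono sum0 eig; split=> [i j ij||i].
- by rewrite lerN2; apply: mono; lia.
- apply: (@eq_trans _ _ (- \sum_(i < N.+1) g i)); last by rewrite sum0 oppr0.
  rewrite sumrN (reindex_inj rev_ord_inj) /=; congr (- _).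
  by apply: eq_bigr => i _; congr (g _); have := ltn_ord i; lia.
- rewrite mulrN -[g _]/(g (rev_ord i)) -eig /lap (reindex_inj rev_ord_inj) /= -sumrN.
  apply: eq_bigr => j _; have ri := ltn_ord i; have rj := ltn_ord j.
  rewrite -mulrN /= (_ : (N - (N.+1 - j.+1) = j)%N); last lia.
  congr (_ * _); last by rewrite /= !subSS; ring.
  by rewrite chain_rev.
Qed.

Lemma nonneg_chain_eigen g : chain_eigen g -> (forall i, (i <= N)%N -> 0 <= g i) ->
  forall i, (i <= N)%N -> g i = 0.
Proof.
case=> _ sum0 _ g0 i iN.
have := psumr_eq0P (fun (i : 'I_N.+1) _ => g0 _ (leq_ord i)) sum0.
by move=> /(_ (Ordinal (iN : (i < N.+1)%N)) isT).
Qed.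

(** With [g 1 = g 2], the eigenvalue equations at positions 0 and 1 give [g 0 = - 2 g 1], so
    [g 1 >= 0] by monotonicity. The first three values then sum to 0, so [g 3] plus a nonnegative
    tail is 0; hence [g 1 = g 0 = 0], and a nonnegative [g] of sum 0 vanishes. *)
Lemma chain_eigen_gap1 g : chain_eigen g -> g 1%N = g 2%N ->
  forall i, (i <= N)%N -> g i = 0.
Proof.
move=> geig g12; have [mono sum0 eig] := geig.
have N1 : (1 < N.+1)%N by lia.
pose c i j : R := (chain_arc N i j || chain_arc N j i)%:R.
have lapE (i : 'I_N.+1) : (i <= 1)%N ->
    lap (@chain N) (fun j => g j) i = \sum_(0 <= j < 3) c i j * (g i - g j).
  move=> i1; rewrite /lap -(big_mkord xpredT (fun j => c i j * (g i - g j))).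
  have N3 : (3 <= N.+1)%N by lia.
  rewrite (big_cat_nat (leq0n 3) N3) /= [X in _ + X]big_nat_cond.
  rewrite [X in _ + X]big1 ?addr0 // => j; rewrite andbT => /andP [j3 _]; rewrite /c.
  case: (boolP (_ || _)); rewrite ?mul0r // /chain_arc; lia.
have := eig ord0; have := eig (Ordinal N1).
rewrite !lapE // !big_nat_recl // !big_geq // /c /chain_arc /=.
rewrite !subrr !mulr0 orbT !mul1r !addr0 !add0r => eq1 eq0.
have g0E : g 0%N + 2 * g 1%N = 0.
  by apply: (mulfI (lt0r_neq0 mu_gt0)); rewrite mulr0 mulrDr -eq0 mulrCA -eq1 g12; ring.
have g01 : g 0%N <= g 1%N by apply: mono; lia.
have g13 : g 1%N <= g 3%N by apply: mono; lia.
have g1_ge0 : 0 <= g 1%N by lra.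
have tail_ge0 : 0 <= \sum_(4 <= i < N.+1) g i.
  rewrite big_nat_cond sumr_ge0 // => i /andP [/andP [i4 iN] _].
  by apply: le_trans g1_ge0 _; apply: mono; lia.
have g1_0 : g 1%N = 0.
  apply/eqP; rewrite eq_le g1_ge0 andbT.
  have N4 : (4 <= N.+1)%N by lia.
  move: sum0; rewrite -(big_mkord xpredT g) (big_cat_nat (leq0n 4) N4) /=.
  by do 4![rewrite big_nat_recl //]; rewrite big_geq // -g12; lra.
apply: nonneg_chain_eigen => // i iN.
by apply: (@le_trans _ _ (g 0%N)); [lra | apply: mono; lia].
Qed.

(** Gap 1 is done, and gap [N.-2] is its mirror image. Any other inner gap is crossed by a single
    edge, with zero flux if the gap is 0; so [g] sums to 0 on each side of the cut, and monotonicity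
    makes it vanish on both. *)
Lemma chain_eigen_gap g k : chain_eigen g -> (0 < k)%N -> (k.+1 < N)%N ->
  gap g k = 0 -> forall i, (i <= N)%N -> g i = 0.
Proof.
move=> geig k0 kN /eqP; rewrite subr_eq0 => /eqP gk.
have [k1|k1] := eqVneq k 1%N.
  by move: gk; rewrite k1 => /esym; apply: chain_eigen_gap1.
have [kM|kM] := eqVneq k N.-2.
  move=> i iN; have := chain_eigen_gap1 (chain_eigen_rev geig).
  move=> /(_ _ (N - i)%N (leq_subr _ _)); rewrite subKn // => gi.
  apply/eqP; rewrite -oppr_eq0; apply/eqP; apply: gi.
  have [N1 N2] : k.+1 = (N - 1)%N /\ k = (N - 2)%N by lia.
  by move: gk; rewrite N1 N2 => ->.
have [mono sum0 eig] := geig.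
have cut0 : \sum_(i < N.+1 | (i <= k)%N) g i = 0.
  apply: (mulfI (lt0r_neq0 mu_gt0)); rewrite mulr0 mulr_sumr.
  under eq_bigr do rewrite -eig.
  rewrite (lap_cut _ (fun i : 'I_N.+1 => (i <= k)%N)); last exact: chain_sym.
  rewrite big1 // => i ik; rewrite big1 // => j jk.
  have [cij|] := boolP (chain i j); last by rewrite mul0r.
  have [-> ->] : (i = k :> nat) /\ (j = k.+1 :> nat).
    by move: ik jk cij k0 kN k1 kM; clear; rewrite /chain /chain_arc; lia.
  by rewrite gk subrr mulr0.
have cut1 : \sum_(i < N.+1 | ~~ (i <= k)%N) g i = 0.
  by move: sum0; rewrite (bigID (fun i : 'I_N.+1 => (i <= k)%N)) /= cut0 add0r.
have low (i : 'I_N.+1) : (i <= k)%N -> g i <= g k by move=> ik; apply: mono; lia.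
have high (i : 'I_N.+1) : ~~ (i <= k)%N -> g k <= g i.
  by move=> ik; rewrite -gk; have := leq_ord i; move=> iN; apply: mono; lia.
have gk0 : g k = 0.
  (* Depending on the sign of [g k = g k.+1], one side has values of constant sign and sum 0, so
     they vanish, including the one next to the cut. *)
  have [gk_le0|gk_gt0] := leP (g k) 0.
    have neg (i : 'I_N.+1) : (i <= k)%N -> 0 <= - g i.
      by move=> /low; rewrite oppr_ge0 => /le_trans; apply.
    have kN1 : (k < N.+1)%N by lia.
    have := psumr_eq0P neg; rewrite sumrN cut0 oppr0 => /(_ erefl (Ordinal kN1) (leqnn _)) /eqP.
    by rewrite oppr_eq0 => /eqP.
  have pos (i : 'I_N.+1) : ~~ (i <= k)%N -> 0 <= g i by move=> /high; apply/le_trans/ltW.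
  have kN1 : (k.+1 < N.+1)%N by lia.
  have := psumr_eq0P pos cut1 (i := Ordinal kN1); rewrite /= ltnn gk; exact.
have low0 (i : 'I_N.+1) : (i <= k)%N -> 0 <= - g i by move=> /low; rewrite oppr_ge0 gk0.
have high0 (i : 'I_N.+1) : ~~ (i <= k)%N -> 0 <= g i by move=> /high; rewrite gk0.
move=> i iN; have iN1 : (i < N.+1)%N by [].
have [ik|ik] := leqP i k; last first.
  by apply: (psumr_eq0P high0 cut1 (i := Ordinal iN1)); rewrite -ltnNge.
have := psumr_eq0P low0; rewrite sumrN cut0 oppr0 => /(_ erefl (Ordinal iN1) ik) /eqP.
by rewrite oppr_eq0 => /eqP.
Qed.

End ChainEigenvector.

(** * Transfer to graphs *)

Lemma eq_energy (R : realDomainType) (T : finType) (e : rel T) (f f' : T -> R) :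
  f =1 f' -> energy e f = energy e f'.
Proof. by move=> ff; apply: eq_bigr => x _; apply: eq_bigr => y _; rewrite !ff. Qed.

Lemma sum_bij (R : nmodType) (S T : finType) (h : S -> T) (F : T -> R) :
  bijective h -> \sum_x F x = \sum_x F (h x).
Proof. by move=> bh; rewrite (reindex h) //; apply: onW_bij. Qed.

Lemma sorted_enumeration (R : realDomainType) (T : finType) (N : nat) (f : T -> R) :
  #|T| = N.+1 -> exists2 s : 'I_N.+1 -> T, bijective s &
    forall i j : 'I_N.+1, (i <= j)%N -> f (s i) <= f (s j).
Proof.
move=> cT; have /card_gt0P [x0 _] : (0 < #|T|)%N by rewrite cT.
pose r := sort (relpre f <=%R) (enum T).
have size_r : size r = N.+1 by rewrite size_sort -cardE.
have lt_r (i : 'I_N.+1) : (i < size r)%N by rewrite size_r.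
exists (fun i : 'I_N.+1 => nth x0 r i).
  apply: inj_card_bij; last by rewrite cT card_ord.
  move=> i j /eqP; rewrite nth_uniq ?lt_r ?sort_uniq ?enum_uniq // => /eqP.
  exact: val_inj.
have r_sorted : sorted (relpre f <=%R) r by apply: sort_sorted => x y; apply: le_total.
move=> i j ij; apply: (sorted_leq_nth _ _ x0 r_sorted); rewrite ?inE ?lt_r //.
- by move=> y x z /=; apply: le_trans.
- by move=> x /=.
Qed.

Lemma connected_cut (T : finType) (e : rel T) (A : pred T) x y :
  connect e x y -> A x -> ~~ A y ->
  exists u v, [/\ A u, ~~ A v & e u v].
Proof.
move=> /connectP [p + ->]; elim: p x => [|z p IH] x /=; first by move=> _ ->.
case/andP => xz pz Ax; have [Az|nAz] := boolP (A z); first exact: IH pz Az.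
by move=> _; exists x, z.
Qed.

(** * The two-triangle graph as a chain *)

Section C33Position.
Variable k : nat.

(** Positions 0 and 1 belong to [a] and [b], so the path starts at 2; [c] and [d] take the last two,
    [k + 4] and [k + 5]. *)
Definition C33_position (x : C33 k) : 'I_(k + 5).+1 :=
  inord match x with
        | inl i => i.+2
        | inr p => (if p.1 then k + 4 else 0) + p.2
        end.

Lemma C33_positionE (x : C33 k) : C33_position x =
  match x with inl i => i.+2 | inr p => (if p.1 then k + 4 else 0) + p.2 end :> nat.
Proof. by rewrite inordK //; case: x => [[i ik]|[[] []]] /=; lia. Qed.

Lemma card_C33 : #|C33 k| = (k + 5).+1.
Proof. by rewrite card_sum card_prod card_bool card_ord; lia. Qed.

Lemma C33_position_bij : bijective C33_position.
Proof.
apply: inj_card_bij; last by rewrite card_C33 card_ord.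
move=> x y /(congr1 (@nat_of_ord _)); rewrite !C33_positionE.
case: x y => [[i ik]|[[] []]] [[j jk]|[[] []]] //= ij; try lia.
by congr (inl _); apply: val_inj => /=; lia.
Qed.

Lemma adj_C33 (x y : C33 k) : adj x y = chain (C33_position x) (C33_position y).
Proof.
rewrite /chain !C33_positionE /chain_arc.
case: x y => [[i ik]|[[] b]] [[j jk]|[[] c]] /=; rewrite -?val_eqE /=;
  try (case: b); try (case: c); apply/idP/idP; lia.
Qed.

End C33Position.

Lemma C33_connected_no_pendant (k : nat) : connected_no_pendant (k + 6) (C33 k).
Proof.
have [h hK Kh] := C33_position_bij k.
have adj_h i j : adj (h i) (h j) = chain i j by rewrite adj_C33 !Kh.
split; first by rewrite card_C33; lia.
  split=> [|x y]; first by rewrite card_C33.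
  have from0 (i : 'I_(k + 5).+1) : connect (@adj (C33 k)) (h ord0) (h i).
    case: i; elim=> [|i IH] iN; first by rewrite (_ : ord0 = Ordinal iN) //; apply: val_inj.
    apply: connect_trans (IH (ltnW iN)) (connect1 _).
    by rewrite adj_h /chain /chain_arc /= eqxx.
  rewrite -(hK x) -(hK y); apply: connect_trans (from0 _).
  by rewrite (sym_connect_sym (@adj_sym _)).
move=> x; rewrite /pendant /degree -(hK x); move: (C33_position x) => i.
(* Two neighbours suffice: 1 and 2 for the first position, [k + 4] and [k + 3] for the last, and
   both adjacent positions otherwise. *)
suff [u [v [uv iu iv]]] : exists u v : 'I_(k + 5).+1, [/\ (u != v :> nat), chain i u & chain i v].
  rewrite neq_ltn; apply/orP; right; apply/card_gt1P; exists (h u), (h v).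
  rewrite !inE !adj_h iu iv; split=> //; apply: contra_neq uv => /(can_inj Kh) ->//.
have iN := leq_ord i.
pose w a b := exists u v : 'I_(k + 5).+1, [/\ u = a :> nat, v = b :> nat & true].
have wP a b : (a <= k + 5)%N -> (b <= k + 5)%N -> w a b.
  by move=> ak bk; exists (Ordinal (ak : (a < (k + 5).+1)%N)), (Ordinal (bk : (b < (k + 5).+1)%N)).
have [i0|i0] := posnP i.
  have [||u [v [ua vb _]]] := wP 1 2; try lia.
  by exists u, v; rewrite /chain /chain_arc; split; lia.
have [iM|iM] := eqVneq (i : nat) (k + 5)%N.
  have [||u [v [ua vb _]]] := wP (k + 4)%N (k + 3)%N; try lia.
  by exists u, v; rewrite /chain /chain_arc; split; lia.
have [||u [v [ua vb _]]] := wP i.-1 i.+1; try lia.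
by exists u, v; rewrite /chain /chain_arc; split; lia.
Qed.

(** Degree 1 is excluded by assumption and degree 0 by connectedness with more than one vertex; of
    two neighbours, one differs from [z]. *)
Lemma second_neighbour (G : sgraph) (n : nat) (x z : G) :
  connected_no_pendant n G -> (1 < n)%N -> exists2 y, y != z & adj x y.
Proof.
case=> cG [_ Gconn] /(_ x) + n1; rewrite /pendant /degree => deg_neq1.
have : (1 < #|[set y | adj x y]|)%N.
  rewrite ltn_neqAle eq_sym deg_neq1; apply/card_gt0P.
  have /card_gt0P [y] : (0 < #|predC1 x|)%N by move: n1; rewrite -cG (cardC1 x); lia.
  rewrite inE => yx.
  have [u [v [/eqP -> _ xv]]] := connected_cut (A := pred1 x) (Gconn x y) (eqxx x) yx.
  by exists v; rewrite inE.
case/card_gt1P => a [b []]; rewrite !inE => xa xb ab.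
by have [az|az] := eqVneq a z; [exists b; rewrite // eq_sym -az | exists a].
Qed.

(** * Comparison of algebraic connectivities and the case of equality *)

Section Comparison.
Variables (R : rcfType) (k : nat) (G : sgraph).
Hypothesis GP : connected_no_pendant (k + 6) G.
Local Notation muC := (algebraic_connectivity R (C33 k)).
Local Notation muG := (algebraic_connectivity R G).

Lemma algebraic_connectivity_C33_le :
  muC <= muG /\ (muG <= muC -> isomorphic G (C33 k)).
Proof.
have [cG Gconn _] := GP.
have [c33 C33conn _] := C33_connected_no_pendant k.
have G1 : (1 < #|G|)%N by rewrite cG; lia.
have C1 : (1 < #|C33 k|)%N by rewrite c33; lia.
have [_ [f [f0 f_gt0 fE]] _] := algebraic_connectivity_spec R Gconn G1.
have [muC_gt0 _ muC_le] := algebraic_connectivity_spec R C33conn C1.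
have [s s_bij s_mono] : exists2 s : 'I_(k + 5).+1 -> G, bijective s &
    forall i j : 'I_(k + 5).+1, (i <= j)%N -> f (s i) <= f (s j).
  by apply: sorted_enumeration; rewrite cG; lia.
have p_bij := C33_position_bij k; have [h hK Kh] := p_bij.
pose g i := f (s (inord i)).
have gE (i : 'I_(k + 5).+1) : g i = f (s i) by rewrite /g inord_val.
pose e : rel 'I_(k + 5).+1 := fun i j => adj (s i) (s j).
have e_irr : irreflexive e by move=> i; apply: adj_irr.
have e_sym : symmetric e by move=> i j; apply: adj_sym.
have [t sK Kt] := s_bij.
have e_deg x z : exists2 y, y != z & e x y.
  have [|y yz xy] := @second_neighbour _ _ (s x) (s z) GP; first lia.
  by exists (t y); rewrite /e ?Kt //; apply: contra_neq yz => <-; rewrite Kt.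
have e_cut l : (l < k + 5)%N ->
    exists i j : 'I_(k + 5).+1, [/\ (i <= l)%N, (l < j)%N & e i j].
  move=> lN; pose A : pred G := fun x => (t x <= l)%N.
  have A0 : A (s ord0) by rewrite /A sK.
  have A1 : ~~ A (s ord_max) by rewrite /A sK -ltnNge.
  have [u [v [Au Av uv]]] := connected_cut (Gconn.2 _ _) A0 A1.
  by exists (t u), (t v); rewrite /e !Kt ltnNge.
have g_mono i j : (i <= j <= k + 5)%N -> g i <= g j.
  by case/andP => ij jN; apply: s_mono; rewrite !inordK //; lia.
have gap_ge0 l : (l < k + 5)%N -> 0 <= gap g l.
  by move=> lN; rewrite subr_ge0 g_mono //; lia.
have N5 : (5 <= k + 5)%N by lia.
have [le_en eq_en] := energy_chain_le N5 e_irr e_sym e_deg e_cut gap_ge0.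
have enG : energy (@adj G) f = energy e (fun i => g i).
  by rewrite (energy_bij _ s_bij (e' := e)) //; apply: eq_energy => i; rewrite gE.
(* The sorted values of [f] moved to the two-triangle graph; sum and norm are unchanged, so [f'] is
   a test function for [muC]. *)
pose f' (x : C33 k) := g (C33_position x).
have enC : energy (@chain (k + 5)) (fun i => g i) = energy (@adj (C33 k)) f'.
  by apply: energy_bij p_bij _ => x y; apply: adj_C33.
have sum_g : \sum_(i < (k + 5).+1) g i = 0.
  by rewrite -[RHS]f0 (sum_bij f s_bij); apply: eq_bigr => i _.
have sum_f' : \sum_x f' x = 0.
  by rewrite -[RHS]sum_g (sum_bij (fun i : 'I_(k + 5).+1 => g i) p_bij).
have sqr_g : \sum_x f x ^+ 2 = \sum_(i < (k + 5).+1) g i ^+ 2.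
  by rewrite (sum_bij _ s_bij); apply: eq_bigr => i _; rewrite gE.
have sqr_f' : \sum_x f' x ^+ 2 = \sum_x f x ^+ 2.
  by rewrite sqr_g (sum_bij (fun i : 'I_(k + 5).+1 => g i ^+ 2) p_bij).
have [le_f' eq_f'] := muC_le f' sum_f'; rewrite sqr_f' in le_f' eq_f'.
have le2 : 2 * (muC * \sum_x f x ^+ 2) <= 2 * (muG * \sum_x f x ^+ 2).
  by rewrite -fE enG (le_trans le_f') // -enC.
have muCG : muC <= muG by move: le2; rewrite ler_pM2l // ler_pM2r.
split=> // muGC; have mu_eq : muG = muC by apply/eqP; rewrite eq_le muGC.
have eq_f : energy (@adj (C33 k)) f' = 2 * (muC * \sum_x f x ^+ 2).
  by apply/eqP; rewrite eq_le le_f' andbT -mu_eq -fE enG -enC.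
(* Since [f'] attains the minimum of the Rayleigh quotient, it is an eigenvector for [muC]. *)
have eig : chain_eigen (k + 5) muC g.
  split=> // i; have := eq_f' eq_f (h i); rewrite /f' Kh => <-.
  rewrite /lap (sum_bij _ p_bij); apply: eq_bigr => x _.
  by rewrite adj_C33 Kh.
have gap_neq0 l : (0 < l)%N -> (l.+1 < k + 5)%N -> gap g l != 0.
  move=> l0 lN; apply/eqP => gl; move: f_gt0; rewrite sqr_g big1 ?ltxx // => i _.
  by rewrite (chain_eigen_gap N5 muC_gt0 eig l0 lN gl) ?leq_ord // expr0n.
(* Gaps [l] and [l.+1] are both inner, hence nonzero, so equality of energies equates the crossing
   numbers, and that of the chain is 0. *)
have crE l : (0 < l)%N -> (l.+2 < k + 5)%N -> crossing e l l.+1 = set0.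
  move=> l0 lN; apply/eqP; rewrite -cards_eq0.
  have lN1 : (l.+1 < k + 5)%N := ltnW lN; have lN0 := ltnW lN1.
  have : energy (@chain (k + 5)) (fun i => g i) == energy e (fun i => g i).
    by rewrite enC eq_f -enG fE mu_eq.
  rewrite eq_en => /forallP /(_ (Ordinal lN0)) /forallP /(_ (Ordinal lN1)).
  have gl : gap g l != 0 by apply: gap_neq0.
  have gl1 : gap g l.+1 != 0 by apply: gap_neq0.
  rewrite mulf_eq0 (negPf gl) (negPf gl1) /=.
  by move=> /eqP <-; rewrite crossing_chain0 // cards0.
have e_chain := crossing0_chain N5 e_irr e_sym e_deg e_cut crE.
exists (h \o t); first by apply: bij_comp; [exists (C33_position (k := k)) | exists s].
by move=> x y; rewrite adj_C33 /= !Kh -e_chain /e !Kt.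
Qed.

End Comparison.

Theorem theorem5p2 (R : realType) (n : nat) (hn : (6 <= n)%N) :
  minimizes_connectivity R (connected_no_pendant n) (C33 (n - 6)) /\
  (forall G : sgraph,
     minimizes_connectivity R (connected_no_pendant n) G ->
     isomorphic G (C33 (n - 6))).
Proof.
have nE : n = (n - 6 + 6)%N by rewrite subnK.
rewrite {1 3}nE; have CP := C33_connected_no_pendant (n - 6); split=> [|G [GP G_min]].
  by split=> // G GP; have [] := algebraic_connectivity_C33_le R GP.
by have [_] := algebraic_connectivity_C33_le R GP; apply; apply: G_min.
Qed.
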